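(* Suppose that for each $\theta\in\Theta$ the unit set $\mathcal U_{\theta,1}$ is nonempty, convex, compact, and contains $0$ in its interior (consequently $\mathcal U_{\theta,\rho}=\rho\,\mathcal U_{\theta,1}$ for all $\rho>0$). Then the coverage-constrained bilevel problem $$\min_{\theta\in\Theta,\ \rho>0} V(\theta,\rho)\quad\text{s.t.}\quad \mathbb P(U\in\mathcal U_{\theta,\rho})\ge\tau \qquad (\mathrm{B})$$ reduces to the problem $$\min_{\theta\in\Theta} J_P(\theta):=V(\theta,\rho_P(\theta)), \qquad (\mathrm{P})$$ in the sense that for each shape $\theta$ the optimal choice of radius in (B) is the smallest feasible one, $\rho=\rho_P(\theta)$.
   Context: Let $d\ge1$ and $\Theta\subseteq\mathbb R^p$. For shape $\theta\in\Theta$ and radius $\rho>0$ the uncertainty set is $\mathcal U_{\theta,\rho}=\{u\in\mathbb R^d: s_\theta(u)\le\rho\}$, where $s_\theta:\mathbb R^d\to[0,\infty)$ is the gauge function (Minkowski functional) of the unit set $\mathcal U_{\theta,1}$, i.e. $s_\theta(u)=\inf\{t>0: u\in t\,\mathcal U_{\theta,1}\}$. The support function of a set $C\subseteq\mathbb R^d$ is $\sigma_C(w)=\sup_{u\in C}\langle w,u\rangle$. Let $\mathcal X\subseteq\mathbb R^{n_x}$ be a closed convex decision set, $f:\mathbb R^{n_x}\to\mathbb R\cup\{+\infty\}$ a convex objective, $a_1,\dots,a_m$ convex constraint functions on $\mathbb R^{n_x}$, $w_1,\dots,w_m\in\mathbb R^d$ fixed exposure vectors and $b_1,\dots,b_m$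 fixed scalars. The robust value function is $$V(\theta,\rho)=\inf\{f(x): x\in\mathcal X,\ a_j(x)+\sigma_{\mathcal U_{\theta,\rho}}(w_j)\le b_j,\ j=1,\dots,m\},$$ with $V(\theta,\rho)=+\infty$ if the feasible set is empty. $U\sim P$ is a random vector in $\mathbb R^d$, $F_\theta(r)=\mathbb P(s_\theta(U)\le r)$ is the gauge score CDF, $\tau\in(0,1)$ is a fixed target coverage, and $\rho_P(\theta)=\inf\{r>0: F_\theta(r)\ge\tau\}$ is the $\tau$-quantile radius.
   Formalization: The optimality of the radius ρ_P(θ) and the equivalence of (B) and (P) are stated under the added condition P(U=0) < τ, equivalent to ρ_P(θ) > 0; otherwise ρ_P(θ) = 0 violates ρ > 0 and no smallest feasible radius exists. *)

(* Defs.v *)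
(* MathComp / MathComp-Analysis; R^k is 'rV[R]_k. *)
From HB Require Import structures.
From mathcomp Require Import all_boot all_order all_algebra.
From mathcomp Require Import all_classical all_reals all_analysis.

Set Implicit Arguments.
Unset Strict Implicit.
Unset Printing Implicit Defensive.

Import Order.TTheory GRing.Theory Num.Theory numFieldNormedType.Exports.
Local Open Scope classical_set_scope.
Local Open Scope ring_scope.

Section Geometry.
Context {R : realType} {d : nat}.
Implicit Types (C : set 'rV[R]_d) (u w : 'rV[R]_d) (s : 'rV[R]_d -> R).

Definition dotp u w : R := \sum_(i < d) u 0 i * w 0 i.

(* Extended-valued, so that the infimum over the empty set is +oo. *)
Definition gauge C u : \bar R :=
  ereal_inf [set t%:E | t in
    [set t : R | 0 < t /\ [set t *: v | v in C] u]].

Definition support_fun C w : \bar R :=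
  ereal_sup [set (dotp w u)%:E | u in C].

(* The uncertainty set of radius rho for the score s = s_theta. *)
Definition uset s (rho : R) : set 'rV[R]_d := [set u | s u <= rho].

End Geometry.

(* Meant for f with values in R and +oo: the library's convex_function only
   covers real-valued functions. *)
Definition econvex_function {R : realType} {n : nat}
    (f : 'rV[R]_n -> \bar R) : Prop :=
  forall (x y : 'rV[R]_n) (t : R), 0 < t < 1 ->
    (f (t *: x + (1 - t) *: y)%R <= t%:E * f x + (1 - t)%:E * f y)%E.

Definition robust_feasible {R : realType} {d n m : nat}
    (X : set 'rV[R]_n) (a : 'I_m -> 'rV[R]_n -> R) (w : 'I_m -> 'rV[R]_d)
    (b : 'I_m -> R) (C : set 'rV[R]_d) : set 'rV[R]_n :=
  [set x | X x /\
    forall j : 'I_m, ((a j x)%:E + support_fun C (w j) <= (b j)%:E)%E].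

(* ereal_inf of the empty set is +oo. *)
Definition robust_value {R : realType} {d n m : nat}
    (X : set 'rV[R]_n) (f : 'rV[R]_n -> \bar R)
    (a : 'I_m -> 'rV[R]_n -> R) (w : 'I_m -> 'rV[R]_d) (b : 'I_m -> R)
    (s : 'rV[R]_d -> R) (rho : R) : \bar R :=
  ereal_inf [set f x | x in robust_feasible X a w b (uset s rho)].

Section Coverage.
Context {R : realType} {disp : measure_display} {Om : measurableType disp}.
Variables (Pr : probability Om R) (d : nat) (U : Om -> 'rV[R]_d).

(* The library has no Borel sigma-algebra on 'rV[R]_d; measurability of the
   coordinates is measurability for the Borel sets of R^d. *)
Definition random_vector : Prop :=
  forall i : 'I_d, measurable_fun [set: Om] (fun o => U o 0 i).

Definition score_cdf (s : 'rV[R]_d -> R) (r : R) : \bar R :=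
  Pr [set o | s (U o) <= r].

(* inf is real-valued and would be 0 on an empty set; the set is nonempty as
   soon as tau < 1 and s is real-valued with s o U measurable. The infimum is 0
   when Pr (s (U) = 0) >= tau. *)
Definition quantile_radius (tau : R) (s : 'rV[R]_d -> R) : R :=
  inf [set r : R | 0 < r /\ (tau%:E <= score_cdf s r)%E].

Definition coverage_radii (tau : R) (s : 'rV[R]_d -> R) : set R :=
  [set rho : R | 0 < rho /\ (tau%:E <= Pr (U @^-1` uset s rho))%E].

Definition bilevel_feasible (tau : R) (p : nat) (Theta : set 'rV[R]_p)
    (s : 'rV[R]_p -> 'rV[R]_d -> R) : set ('rV[R]_p * R) :=
  [set q | Theta q.1 /\ coverage_radii tau (s q.1) q.2].

End Coverage.

Definition is_minimizer {R : realType} {T : Type} (A : set T)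
    (g : T -> \bar R) (x : T) : Prop :=
  A x /\ forall y, A y -> (g x <= g y)%E.

Definition min_value {R : realType} {T : Type} (A : set T)
    (g : T -> \bar R) : \bar R :=
  ereal_inf [set g x | x in A].

(* Main.v *)
Require Import Defs.
From HB Require Import structures.
From mathcomp Require Import all_boot all_order all_algebra.
From mathcomp Require Import all_classical all_reals all_analysis.
From mathcomp Require Import measurable_realfun lra.

Import Order.TTheory GRing.Theory Num.Theory numFieldNormedType.Exports.
Local Open Scope classical_set_scope.
Local Open Scope ring_scope.

(** For a fixed shape, enlarging the radius enlarges the uncertainty set, hence
its support function, hence tightens every robust constraint: the robust value
is nondecreasing in the radius ([robust_value_le]).  It is therefore enough to
know that the radii meeting the coverage constraint form the half-line starting
at the quantile radius, intersected with the positive reals.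

That is a statement about the distribution function of the score s(U).  Its
limit at infinity is 1 > tau, so some radius reaches coverage tau; it is
nondecreasing and right-continuous, so the infimum of the radii reaching
coverage tau reaches it too ([quantile_coverage]).  Both facts hold for random
variables, so one must first see that s(U) is one.  The sublevel sets of s are
closed, because s is positively homogeneous (being a gauge) and its unit
sublevel set is compact ([closed_uset]); closed sets have measurable preimages
under U, because an open set of R^d is a countable union of rational boxes
([measurable_preimage_open]).

The quantile radius is itself an admissible, positive radius exactly when
P(U = 0) < tau: compactness of the unit set makes 0 the only point of score 0
([score_eq0]), so P(U = 0) is the value of the distribution function at 0
([quantile_gt0]).  In that case it minimizes the value over each fibre of the
bilevel problem, and minimizing over pairs amounts to minimizing over shapes
after substituting the fibrewise minimizer (section [ProfileMinimization]). *)

(** * Measurability along a random vector *)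

Section PreimageMeasurable.
Context {R : realType} {disp : measure_display} {Om : measurableType disp}.
Context {d : nat} {U : Om -> 'rV[R]_d}.
Hypothesis U_random : random_vector U.

Lemma measurable_preimage_box (c : 'rV[R]_d) (e : R) :
  measurable (U @^-1` [set y | forall i, `|y 0 i - c 0 i| < e]).
Proof.
rewrite (_ : _ @^-1` _ =
    \bigcap_(i in [set: 'I_d]) ((fun o => U o 0 i) @^-1` ball (c 0 i) e)).
  apply: fin_bigcap_measurable => // i _; rewrite -[_ @^-1` _]setTI.
  by apply: U_random => //; exact: measurable_ball.
apply/seteqP; split => o /= h i.
  by move=> _; rewrite -ball_normE /= distrC.
by have := h i I; rewrite -ball_normE /= distrC.
Qed.

(** The topology of R^d has a countable base of boxes with rational centre and
radius 1 / (k + 1); the preimage of a box is a finite intersection of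
preimages by the coordinates. *)
Lemma measurable_preimage_open (O : set 'rV[R]_d) :
  open O -> measurable (U @^-1` O).
Proof.
move=> oO.
pose box (c : 'rV[rat]_d) k : set 'rV[R]_d :=
  [set y | forall i, `|y 0 i - (map_mx ratr c : 'rV[R]_d) 0 i| < k.+1%:R^-1].
rewrite (_ : U @^-1` O = \bigcup_(ck : 'rV[rat]_d * nat)
    if asbool (box ck.1 ck.2 `<=` O) then U @^-1` box ck.1 ck.2 else set0).
  apply: countable_bigcupT_measurable; first exact: countableP.
  by move=> [c k] /=; case: ifP => // _; exact: measurable_preimage_box.
apply/seteqP; split=> [z /= Oz|z [[c k] _] /=]; last first.
  by case: ifPn => // /asboolP; apply.
have /nbhs_ballP[e /= e0 eO] : nbhs (U z) O by exact: open_nbhs_nbhs.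
(* Half of e suffices: a point of the box is within 1 / (k + 1) of the rational
   centre, which is itself that close to U z. *)
have [k ke] : exists k, 0 + k.+1%:R^-1 < e / 2.
  by apply: ltr_add_invr; rewrite divr_gt0.
rewrite add0r in ke.
have close i : {q : rat | `|U z 0 i - ratr q| < k.+1%:R^-1}.
  apply: cid; have [|q] := @rat_in_itvoo R (U z 0 i - k.+1%:R^-1)
      (U z 0 i + k.+1%:R^-1).
    by rewrite ltrBlDr -addrA ltrDl addr_gt0.
  by rewrite in_itv /= => hq; exists q; rewrite distrC ltr_distl.
pose c : 'rV[rat]_d := \row_i sval (close i).
have boxz : box c k (U z) by move=> i; rewrite !mxE; exact: (svalP (close i)).
have boxO : box c k `<=` O.
  move=> y boxy; apply: eO; split => // i j; rewrite !ord1 -ball_normE /=.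
  rewrite (le_lt_trans (ler_distD ((map_mx ratr c : 'rV[R]_d) 0 j) _ _))//.
  rewrite (splitr e) ltrD// (lt_trans _ ke)//.
  by rewrite distrC; exact: boxy.
by exists (c, k) => //=; rewrite asboolT.
Qed.

Lemma measurable_preimage_closed (C : set 'rV[R]_d) :
  closed C -> measurable (U @^-1` C).
Proof.
move=> cC; rewrite -[C]setCK preimage_setC; apply: measurableC.
exact: measurable_preimage_open _ (closed_openC cC).
Qed.

(** Having closed sublevel sets is lower semicontinuity, and the preimages of
the rays bounded below already generate the Borel sets of the line. *)
Lemma measurable_comp_closed_sublevel (s : 'rV[R]_d -> R) :
  (forall r, closed (uset s r)) -> measurable_fun [set: Om] (s \o U).
Proof.
move=> cs; apply: (measurability _ (RGenOInfty.measurableE R)) => //.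
move=> _ [_ [r ->] <-]; rewrite setTI.
rewrite (_ : _ @^-1` _ = ~` (U @^-1` uset s r)).
  exact/measurableC/measurable_preimage_closed.
by apply/seteqP; split => z /=; rewrite in_itv /= andbT ltNge => /negP.
Qed.
End PreimageMeasurable.

(** * Gauges of compact neighbourhoods of the origin *)

Section Gauge.
Context {R : realType} {d : nat} {s : 'rV[R]_d -> R}.
Hypothesis s_ge0 : forall u, 0 <= s u.
Hypothesis s_gauge : forall u, (s u)%:E = gauge (uset s 1) u.

(** The direction of the gauge definition that produces upper bounds: t is one
of the dilation factors over which the infimum is taken. *)
Lemma score_le (u : 'rV[R]_d) (t : R) :
  0 < t -> s (t^-1 *: u) <= 1 -> s u <= t.
Proof.
move=> t0 st; rewrite -lee_fin s_gauge; apply: ereal_inf_lbound.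
exists t => //; split => //; exists (t^-1 *: u) => //.
by rewrite scalerA divff ?scale1r// gt_eqF.
Qed.

(** One inequality is enough for homogeneity, since it can be applied again with
the inverse factor. *)
Lemma score_le_scale (r : R) (u : 'rV[R]_d) : 0 < r -> s (r *: u) <= r * s u.
Proof.
move=> r0; rewrite -ler_pdivrMl// -lee_fin s_gauge.
apply: le_ereal_inf_tmp => _ [t [t0 [v /= sv <-]] <-].
rewrite lee_fin ler_pdivrMl//; apply: score_le; first by rewrite mulr_gt0.
by rewrite !scalerA mulVf ?scale1r// gt_eqF// mulr_gt0.
Qed.

Lemma score_scale (r : R) (u : 'rV[R]_d) : 0 < r -> s (r *: u) = r * s u.
Proof.
move=> r0; apply/eqP; rewrite eq_le score_le_scale//=.
rewrite -ler_pdivlMl//.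
rewrite -{1}[u](@scalerK _ _ r) ?gt_eqF//; apply: score_le_scale.
by rewrite invr_gt0.
Qed.

Lemma uset_scale (rho : R) : 0 < rho ->
  uset s rho = [set rho *: u | u in uset s 1].
Proof.
move=> rho0; apply/seteqP; split => [u /= su|_ [u /= su <-]].
  exists (rho^-1 *: u); last by rewrite scalerKV// gt_eqF.
  by rewrite /uset /= score_scale ?invr_gt0// ler_pdivrMl// mulr1.
by rewrite /uset /= score_scale// ler_piMr// ltW.
Qed.

Hypothesis unit_compact : compact (uset s 1).
Hypothesis unit_interior : interior (uset s 1) 0.

(** A point of score 0 lies in every dilate of the unit set; the unit set being
bounded, these dilates shrink to the origin. *)
Lemma score_eq0 (u : 'rV[R]_d) : (s u <= 0) = (u == 0).
Proof.
apply/idP/eqP => [su|->]; last first.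
  have s01 : s 0 <= 1 := @interior_subset _ _ _ unit_interior.
  have := @score_scale 2^-1 0 ltac:(by rewrite invr_gt0).
  by rewrite scaler0; lra.
have [M [_ Mbound]] := compact_bounded unit_compact.
apply/eqP; rewrite -normr_le0; apply/ler_addgt0Pl => e e0; rewrite addr0.
(* The factor N / e brings the bound N on the unit set down to e on u. *)
pose N := `|M| + 1.
have N0 : 0 < N by rewrite ltr_wpDl.
have : `|(N / e) *: u| <= N.
  apply: Mbound; first by rewrite (le_lt_trans (ler_norm M))// ltrDl.
  rewrite /uset /= score_scale ?divr_gt0//.
  by rewrite (le_trans _ ler01)// pmulr_rle0// divr_gt0.
by rewrite normrZ gtr0_norm ?divr_gt0// mulrAC ler_pdivrMr// ler_pM2l//.
Qed.

(** Closedness at positive radii follows from compactness at radius 1 by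
rescaling; radius 0 needs [score_eq0] because no rescaling reaches it. *)
Lemma closed_uset (r : R) : closed (uset s r).
Proof.
have cl1 : closed (uset s 1) by exact: compact_closed (@norm_hausdorff _ _) _.
have [r0|r0|->] := ltgtP r 0.
- rewrite (_ : uset s r = set0); first exact: closed0.
  apply/seteqP; split => // u /= su.
  by have := lt_le_trans r0 (s_ge0 u); rewrite ltNge su.
- rewrite (_ : uset s r = ( *:%R r^-1) @^-1` uset s 1).
    by apply: preimage_closed => // u _; exact: scaler_continuous.
  by apply/seteqP; split => u;
    rewrite /uset /= score_scale ?invr_gt0// ler_pdivrMl// mulr1.
- rewrite (_ : uset s 0 = [set 0]).
    exact/accessible_closed_set1/hausdorff_accessible/norm_hausdorff.
  by apply/seteqP; split => u; rewrite /uset /= score_eq0 => /eqP.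
Qed.
End Gauge.

(** * Quantiles of a random variable over the positive reals *)

Section Quantile.
Context {R : realType} {disp : measure_display} {Om : measurableType disp}.
Context {P : probability Om R} {Z : Om -> R}.
Hypothesis Z_measurable : measurable_fun [set: Om] Z.
Context {tau : R}.
Hypothesis tau_lt1 : tau < 1.

Let F r : \bar R := P [set o | Z o <= r].
Let A : set R := [set r | 0 < r /\ (tau%:E <= F r)%E].

Let X : {RV P >-> R} := mfun_Sub (mem_set Z_measurable).

Let cdfE : cdf X = F.
Proof.
by apply/funext => r; rewrite /cdf /distribution /pushforward /F; congr (P _).
Qed.

Lemma quantile_set_neq0 : A !=set0.
Proof.
have tau_nbhs : nbhs (1%E : \bar R) [set y | (tau%:E < y)%E].
  apply: open_nbhs_nbhs; split; first exact: open_ereal_gt_ereal.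
  by rewrite /= lte_fin.
have [r r0 tau_r] := pinfty_ex_gt0 (cvg_cdfy1 X tau_nbhs).
by exists r; split => //; rewrite -cdfE; exact: ltW.
Qed.

Lemma has_lbound_quantile_set : has_lbound A.
Proof. by exists 0 => r [/ltW]. Qed.

(** Every t > r exceeds an element of A, so F t >= tau, and this passes to the
limit as t decreases to r.  The statement is about [inf A <= r] rather than
membership in A so as to reach r = inf A and, in [quantile_gt0], r = 0, which
lies outside A. *)
Lemma quantile_coverage (r : R) : inf A <= r -> (tau%:E <= F r)%E.
Proof.
move=> infr; rewrite -cdfE.
have cdf_r : cdf X x @[x --> r^'+] --> cdf X r := cdf_right_continuous (x := r).
apply: cvge_ge cdf_r.
near=> t.
have /(inf_lt quantile_set_neq0)[t' [_ tau_t'] t't] : inf A < t.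
  by rewrite (le_lt_trans infr).
rewrite (le_trans tau_t')// -cdfE.
by apply: cdf_nondecreasing; exact: ltW.
Unshelve. all: by end_near. Qed.

Lemma quantile_setE : A = [set r | 0 < r /\ inf A <= r].
Proof.
apply/seteqP; split => r [r0 h]; split => //; last exact: quantile_coverage.
exact: ge_inf has_lbound_quantile_set _ (conj r0 h).
Qed.

(** If F 0 >= tau, then A is the whole set of positive reals, with infimum 0;
otherwise right continuity at 0 keeps the infimum away from 0. *)
Lemma quantile_gt0 : 0 < inf A <-> (F 0%R < tau%:E)%E.
Proof.
split=> [q0|F0]; last first.
  by rewrite ltNge; apply/negP => /quantile_coverage; rewrite leNgt F0.
rewrite ltNge; apply/negP => tauF0.
have : A (inf A / 2).
  split; first by rewrite divr_gt0.
  rewrite (le_trans tauF0)// -cdfE; apply: cdf_nondecreasing.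
  by rewrite ltW// divr_gt0.
move=> /(ge_inf has_lbound_quantile_set); apply/negP; rewrite -ltNge.
by rewrite gtr_pMr// invf_lt1// ltr1n.
Qed.
End Quantile.

(** * Monotone value functions and nested minimization *)

Lemma support_fun_subset {R : realType} {d : nat} (C D : set 'rV[R]_d) w :
  C `<=` D -> (support_fun C w <= support_fun D w)%E.
Proof. by move=> CD; apply: le_ereal_sup; exact: image_subset. Qed.

Lemma robust_value_le {R : realType} {d n m : nat} (X : set 'rV[R]_n)
    (f : 'rV[R]_n -> \bar R) (a : 'I_m -> 'rV[R]_n -> R) (w : 'I_m -> 'rV[R]_d)
    (b : 'I_m -> R) (s : 'rV[R]_d -> R) (r r' : R) : r <= r' ->
  (robust_value X f a w b s r <= robust_value X f a w b s r')%E.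
Proof.
move=> rr'; apply: le_ereal_inf; apply: image_subset => x [Xx ax].
split => // j; apply: le_trans (ax j); apply: leeD2l.
by apply: support_fun_subset => u /= su; exact: le_trans su rr'.
Qed.

Lemma min_value_minimizer {R : realType} {T : Type} (A : set T)
    (g : T -> \bar R) (x : T) : is_minimizer A g x -> min_value A g = g x.
Proof.
move=> [Ax gx]; apply/eqP; rewrite eq_le; apply/andP; split.
  by apply: ereal_inf_lbound; exists x.
by apply: le_ereal_inf_tmp => _ [y Ay <-]; exact: gx.
Qed.

(** Minimization in two stages: a joint minimum over pairs (x, y) is a minimum
over x once the best y of every fibre is substituted. *)
Section ProfileMinimization.
Context {R : realType} {S T : Type} {D : set S} {fiber : S -> set T}.
Context {g : S * T -> \bar R} {best : S -> T}.
Hypothesis best_min : forall x, D x ->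
  is_minimizer (fiber x) (fun y => g (x, y)) (best x).

Let joint := [set q : S * T | D q.1 /\ fiber q.1 q.2].
Let profile x := g (x, best x).

Lemma min_value_profile : min_value joint g = min_value D profile.
Proof.
apply/eqP; rewrite eq_le; apply/andP; split; apply: le_ereal_inf_tmp.
  move=> _ [x Dx <-]; apply: ereal_inf_lbound; exists (x, best x) => //.
  by split => //; case: (best_min x Dx).
move=> _ [[x y] [/= Dx xy] <-].
apply: (le_trans _ ((best_min x Dx).2 y xy)).
by apply: ereal_inf_lbound; exists x.
Qed.

Lemma minimizer_profileP (x : S) :
  is_minimizer D profile x <-> is_minimizer joint g (x, best x).
Proof.
split=> [[Dx px]|[[/= Dx _] jx]].
  split=> [|[x' y] [/= Dx' xy]]; first by split => //; case: (best_min x Dx).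
  exact: le_trans (px x' Dx') ((best_min x' Dx').2 y xy).
split=> // x' Dx'; apply: (jx (x', best x')).
by split => //; case: (best_min x' Dx').
Qed.

(** The second component of a joint minimizer may differ from [best x], as the
minimum over the fibre need not be attained only once. *)
Lemma joint_minimizer_profile (x : S) (y : T) :
  is_minimizer joint g (x, y) ->
  is_minimizer D profile x /\ g (x, y) = profile x.
Proof.
move=> [[/= Dx xy] jxy].
have [bx bxmin] := best_min x Dx.
have gE : g (x, y) = profile x.
  by apply/eqP; rewrite eq_le (jxy (x, best x))//= bxmin.
split => //; split => // x' Dx'; rewrite -gE; apply: (jxy (x', best x')).
by split => //; case: (best_min x' Dx').
Qed.
End ProfileMinimization.

(** * The coverage-constrained problem *)

Theorem proposition1 (R : realType) (d p n m : nat) (d_ge1 : (1 <= d)%N)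
    (Theta : set 'rV[R]_p)
    (s : 'rV[R]_p -> 'rV[R]_d -> R)
    (s_ge0 : forall theta, Theta theta -> forall u, 0 <= s theta u)
    (s_gauge : forall theta, Theta theta ->
       forall u, (s theta u)%:E = gauge (uset (s theta) 1) u)
    (X : set 'rV[R]_n) (X_closed : closed X) (X_convex : convex_set X)
    (f : 'rV[R]_n -> \bar R) (f_proper : forall x, f x != -oo%E)
    (f_convex : econvex_function f)
    (a : 'I_m -> 'rV[R]_n -> R)
    (a_convex : forall j, convex_function [set: 'rV[R]_n] (a j))
    (w : 'I_m -> 'rV[R]_d) (b : 'I_m -> R)
    (disp : measure_display) (Om : measurableType disp)
    (Pr : probability Om R) (U : Om -> 'rV[R]_d)
    (U_random : random_vector U)
    (tau : R) (tau_in01 : 0 < tau < 1)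
    (unit_set : forall theta, Theta theta ->
       [/\ uset (s theta) 1 !=set0,
           convex_set (uset (s theta) 1),
           compact (uset (s theta) 1) &
           interior (uset (s theta) 1) 0]) :
  let V := fun theta rho => robust_value X f a w b (s theta) rho in
  let rhoP := fun theta => quantile_radius Pr U tau (s theta) in
  let J := fun theta => V theta (rhoP theta) in
  let radii := fun theta => coverage_radii Pr U tau (s theta) in
  let B := bilevel_feasible Pr U tau Theta s in
  let VB := fun q : 'rV[R]_p * R => V q.1 q.2 in
  (forall theta, Theta theta ->
     [/\ forall rho : R, 0 < rho ->
           uset (s theta) rho = [set rho *: u | u in uset (s theta) 1],
         radii theta = [set rho : R | 0 < rho /\ rhoP theta <= rho],
         forall rho : R, radii theta rho -> (J theta <= V theta rho)%E &
         0 < rhoP theta <-> (Pr [set o | U o = 0%R] < tau%:E)%E]) /\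
  ((Pr [set o | U o = 0%R] < tau%:E)%E ->
     (forall theta, Theta theta ->
        [/\ radii theta (rhoP theta),
            forall rho : R, radii theta rho -> rhoP theta <= rho,
            is_minimizer (radii theta) (V theta) (rhoP theta) &
            min_value (radii theta) (V theta) = J theta]) /\
     [/\ min_value B VB = min_value Theta J,
         forall theta, is_minimizer Theta J theta <->
                       is_minimizer B VB (theta, rhoP theta) &
         forall theta rho, is_minimizer B VB (theta, rho) ->
           is_minimizer Theta J theta /\ V theta rho = J theta]).
Proof.
move=> V rhoP J radii B VB.
have [_ tau1] := andP tau_in01.
have score_measurable theta : Theta theta ->
    measurable_fun [set: Om] (s theta \o U).
  move=> Ttheta; have [_ _ unit_compact unit_int] := unit_set _ Ttheta.
  apply: (measurable_comp_closed_sublevel U_random) => r.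
  exact: closed_uset (s_ge0 _ Ttheta) (s_gauge _ Ttheta) unit_compact
    unit_int r.
have radiiE theta : Theta theta ->
    radii theta = [set rho : R | 0 < rho /\ rhoP theta <= rho].
  by move=> Ttheta; exact: (quantile_setE (score_measurable _ Ttheta) tau1).
have V_le theta r r' : r <= r' -> (V theta r <= V theta r')%E.
  exact: robust_value_le.
have rhoP_gt0 theta : Theta theta ->
    0 < rhoP theta <-> (Pr [set o | U o = 0%R] < tau%:E)%E.
  move=> Ttheta; have [_ _ unit_compact unit_int] := unit_set _ Ttheta.
  rewrite (_ : [set o | U o = 0] = [set o | s theta (U o) <= 0]).
    exact: (quantile_gt0 (score_measurable _ Ttheta) tau1).
  apply/seteqP; split => o /=;
    by rewrite (score_eq0 (s_gauge _ Ttheta) unit_compact unit_int) => /eqP.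
split=> [theta Ttheta|P0_lt].
  split; [exact: uset_scale (s_gauge _ Ttheta) | exact: radiiE | |
          exact: rhoP_gt0].
  by move=> rho; rewrite radiiE// => -[_ rho_ge]; exact: V_le.
have rhoP_min theta : Theta theta ->
    is_minimizer (radii theta) (V theta) (rhoP theta).
  move=> Ttheta; rewrite radiiE//; split; first by split => //; exact/rhoP_gt0.
  by move=> rho [_ rho_ge]; exact: V_le.
split=> [theta Ttheta|].
  split; [by case: (rhoP_min _ Ttheta) | | exact: rhoP_min | ].
    by move=> rho; rewrite radiiE// => -[].
  exact: (min_value_minimizer _ _ _ (rhoP_min _ Ttheta)).
split.
- exact: (@min_value_profile _ _ _ Theta radii VB rhoP rhoP_min).
- exact: (@minimizer_profileP _ _ _ Theta radii VB rhoP rhoP_min).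
- exact: (@joint_minimizer_profile _ _ _ Theta radii VB rhoP rhoP_min).
Qed.
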